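(* Let $H$ be a limit circle Hamburger Hamiltonian with lengths $(l_j)_{j=1}^\infty$ and angles $(\phi_j)_{j=1}^\infty$, and suppose that $\sum_{j=1}^\infty|\sin(\phi_{j+1}-\phi_j)|<\infty$. Let $G\colon\mathbb{N}\to(0,\infty)$ be the decreasing function $$G(N):=\frac1N\Big(\sum_{j=N+1}^\infty l_j\Big)^{\frac12}\Big(\sum_{j=N+1}^\infty|\sin(\phi_{j+1}-\phi_j)|\Big)^{\frac12}.$$ Then there is a constant $C>0$ such that $$\log|w_{H,22}(ir)|\ \le\ C\,G^-\Big(\frac{\log r}{\sqrt r}\Big)\cdot\log r$$ for all sufficiently large $r$, where $G^-(x):=\min\{N\in\mathbb{N} : G(N)<x\}$.
   Context: Limit circle Hamburger Hamiltonian: let $(l_j)_{j=1}^\infty$ be positive numbers (''lengths'') with $L:=\sum_{j=1}^\infty l_j<\infty$, and $(\phi_j)_{j=1}^\infty$ real numbers (''angles'') with $\phi_{j+1}-\phi_j\notin\pi\mathbb{Z}$ for all $j$. Put $x_0:=0$, $x_n:=\sum_{j=1}^n l_j$, $\xi_\phi:=(\cos\phi,\sin\phi)^\top$, and $H(t):=\xi_{\phi_j}\xi_{\phi_j}^\top$ for $x_{j-1}\le t<x_j$, $j\in\mathbb{N}$; this defines $H$ on $(0,L)$. Monodromy matrix: with $J=\begin{pmatrix}0&-1\\1&0\end{pmatrix}$, for $z\in\mathbb{C}$ let $W_H(t;z)$ be the solution of $\frac{d}{dt}W_H(t;z)J=zW_H(t;z)H(t)$ for a.e. $t\in(0,L)$,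 $W_H(0;z)=I$. It exists up to $t=L$, and $W_H(z):=W_H(L;z)=(w_{H,ij}(z))_{i,j=1}^2$. Here $\mathbb{N}=\{1,2,\dots\}$. *)

(* Defs.v *)
From HB Require Import structures.
From mathcomp Require Import all_boot all_order all_algebra.
From mathcomp Require Import all_classical all_reals all_analysis.
From mathcomp Require Import complex.
Set Implicit Arguments.
Unset Strict Implicit.
Unset Printing Implicit Defensive.
Import Order.TTheory GRing.Theory Num.Theory.
Import numFieldNormedType.Exports.
Local Open Scope classical_set_scope.
Local Open Scope ring_scope.

(* Sequences over {1, 2, ...} are functions on nat whose value at 0 is never
   used. Infinite sums are limits of real partial sums, so they only have their
   intended meaning for convergent series. *)

Definition node (R : realType) (l : nat -> R) (n : nat) : R :=
  \sum_(1 <= j < n.+1) l j.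

(* u (N+1) + u (N+2) + ... *)
Definition tail_sum (R : realType) (u : nat -> R) (N : nat) : R :=
  limn (fun n : nat => \sum_(N.+1 <= j < n) u j).

Definition total_length (R : realType) (l : nat -> R) : R := tail_sum l 0.

(* "Limit circle" is the convergence of the sum of the lengths. *)
Definition limit_circle_hamburger (R : realType) (l phi : nat -> R) : Prop :=
  [/\ forall j, (0 < j)%N -> 0 < l j,
      cvgn (fun n : nat => \sum_(1 <= j < n) l j)
    & forall j, (0 < j)%N -> forall k : int, phi j.+1 - phi j <> k%:~R * pi].

Definition xi (R : realType) (a : R) : 'cV[R]_2 :=
  \col_(i < 2) (if i == 0 then cos a else sin a).

(* The unique j >= 1 with x_(j-1) <= t < x_j when 0 <= t < L; arbitrary for
   other t. *)
Definition piece (R : realType) (l : nat -> R) (t : R) : nat :=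
  xget 1%N [set j | (0 < j)%N /\ node l j.-1 <= t < node l j].

(* Only meaningful on [0, L). *)
Definition hamiltonian (R : realType) (l phi : nat -> R) (t : R) : 'M[R]_2 :=
  xi (phi (piece l t)) *m (xi (phi (piece l t)))^T.

Definition Jmx (F : pzRingType) : 'M[F]_2 :=
  \matrix_(i < 2, j < 2)
    (if (i == 0) && (j == 1) then -1 else if (i == 1) && (j == 0) then 1 else 0).

Definition abs_continuous (R : realType) (a b : R) (f : R -> R) : Prop :=
  forall e : R, 0 < e -> exists2 d : R, 0 < d &
    forall (n : nat) (u v : 'I_n -> R),
      (forall i, [/\ a <= u i, u i <= v i & v i <= b]) ->
      trivIset [set: 'I_n] (fun i => [set` `]u i, v i[]) ->
      \sum_(i < n) (v i - u i) < d ->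
      \sum_(i < n) `|f (v i) - f (u i)| < e.

Definition abs_continuous_mx (R : realType) (a b : R)
    (W : R -> 'M[R[i]]_2) : Prop :=
  forall i k, abs_continuous a b (fun t => complex.Re (W t i k)) /\
              abs_continuous a b (fun t => complex.Im (W t i k)).

(* Entrywise derivative of a complex matrix function of a real variable. *)
Definition is_derive_mx (R : realType) (t : R)
    (W : R -> 'M[R[i]]_2) (D : 'M[R[i]]_2) : Prop :=
  forall i k,
    is_derive t 1 (fun s => complex.Re (W s i k)) (complex.Re (D i k)) /\
    is_derive t 1 (fun s => complex.Im (W s i k)) (complex.Im (D i k)).

(* W = W_H( . ; z) on [0, L]: an a.e. solution of the canonical system is
   understood, as usual, to be absolutely continuous. *)
Definition is_fundamental_solution (R : realType) (L : R) (H : R -> 'M[R]_2)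
    (z : R[i]) (W : R -> 'M[R[i]]_2) : Prop :=
  [/\ abs_continuous_mx 0 L W,
      W 0 = 1%:M
    & {ae (@lebesgue_measure R), forall t, 0 < t < L ->
        is_derive_mx t (fun s => W s *m Jmx R[i])
          (z *: (W t *m map_mx (real_complex R) (H t)))}].

Definition Gfun (R : realType) (l phi : nat -> R) (N : nat) : R :=
  N%:R^-1 * Num.sqrt (tail_sum l N)
          * Num.sqrt (tail_sum (fun j => `|sin (phi j.+1 - phi j)|) N).

(* min {N >= 1 | G N < x}, with junk value 0 if there is no such N. *)
Definition lower_inverse (R : realType) (G : nat -> R) (x : R) : nat :=
  xget 0%N [set N | [/\ (0 < N)%N, G N < x &
    forall M, (0 < M)%N -> G M < x -> (N <= M)%N]].

(* Main.v *)
Require Import Defs.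
From HB Require Import structures.
From mathcomp Require Import all_boot all_order all_algebra.
From mathcomp Require Import all_classical all_reals all_analysis.
From mathcomp Require Import complex.
From mathcomp Require Import ring lra.
Import Order.TTheory GRing.Theory Num.Theory.
Import numFieldNormedType.Exports.
Local Open Scope classical_set_scope.
Local Open Scope ring_scope.

(** Only the second row w = (w_1, w_2) of W is needed. On an interval where
    the angle is phi_j, write p = w . xi and q = w . xi^perp for the
    components of w along xi = (cos phi_j, sin phi_j) and along
    xi^perp = (- sin phi_j, cos phi_j). The canonical system becomes p' = 0,
    q' = z p, so that across an interval of length l_j only q changes, by
    z l_j p; passing to the next angle rotates (p, q) by
    delta_j = phi_(j+1) - phi_j.

    For z = ir and a weight 0 < rho <= 1, the norm |p| + rho |q| grows by a
    factor of at most 1 + rho r l_j across an interval ([wnorm_piece]) and by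
    at most 1 + |sin delta_j| / rho at a change of angle ([wnorm_rotate]).
    With rho = 1 the first N intervals contribute at most
    exp (sum_j |sin delta_j|) (r e^L)^N ([row_growth_crude]). With a general
    rho the intervals after the N-th contribute at most
    exp (S_N / rho + rho r Lambda_N) ([row_growth]), where Lambda_N and S_N are
    the tails of the sums of the l_j and of the |sin delta_j|. Changing the
    weight from 1 to rho and back costs a factor of 1 / rho only. There is a
    rho in [1/r, 1] that makes the exponent at most
    2 sqrt (r Lambda_N S_N) + O(1) ([optimal_weight]), so
      log |w_2(L)| <= O(1) + O(log r) + N (log r + L) + 2 sqrt (r Lambda_N S_N)
    ([row_end_bound]). The last square root is sqrt r * N * G(N), which is
    below N log r as soon as G(N) < log r / sqrt r; this is how N is chosen.

    The system holds almost everywhere only, so solving it on an interval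
    rests on the fact that an absolutely continuous function whose derivative
    vanishes almost everywhere is constant ([abs_continuous_derive0]). *)

Set Implicit Arguments.
Unset Strict Implicit.
Unset Printing Implicit Defensive.

(** * Absolutely continuous functions *)

(** Continuous induction: a property that holds at [a], and that can be carried
    from the left to the right of every point of [[a, b]], holds at [b]. *)
Lemma interval_induction (R : realType) (a b : R) (Q : R -> Prop) :
  a <= b -> Q a ->
  (forall t, a <= t <= b -> exists2 d, 0 < d & forall u v,
     a <= u -> u <= t <= v -> v <= b -> t - d < u -> v < t + d -> Q u -> Q v) ->
  Q b.
Proof.
move=> ab Qa step.
pose A := [set c | a <= c <= b /\ Q c].
have Aa : A a by split=> //; rewrite lexx.
have Aub : ubound A b by move=> c [/andP[]].
have supA : has_sup A by split; [exists a | exists b].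
have a_sup : a <= sup A by apply: ub_le_sup => //; exists b.
have sup_b : sup A <= b by apply: ge_sup => //; exists a.
have [|d d_gt0 stepd] := step (sup A); first by rewrite a_sup.
have [u [/andP[au ub] Qu] dlt] := sup_adherent d_gt0 supA.
have u_sup : u <= sup A by apply: ub_le_sup => //; [exists b | split=> //; rewrite au].
(* The step at [sup A] reaches beyond it unless it reaches [b]. *)
pose v := Num.min b (sup A + d / 2).
have sup_v : sup A <= v by rewrite le_min sup_b /= lerDl divr_ge0// ltW.
have vb : v <= b by rewrite ge_min lexx.
have Qv : Q v.
  apply: (stepd u) => //; first by rewrite u_sup.
  by rewrite gt_min ltrD2l ltr_pdivrMr// ltr_pMr// ltr1n orbT.
have v_sup : v <= sup A.
  by apply: ub_le_sup; [exists b | split=> //; rewrite (le_trans a_sup)].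
suff -> : b = v by [].
apply/eqP; rewrite eq_le vb andbT leNgt; apply/negP => vltb.
move: v_sup; rewrite /v; case: (leP b (sup A + d / 2)) => h.
  by move: vltb; rewrite /v min_l// ltxx.
by move=> ?; have := divr_gt0 d_gt0 (ltr0Sn R 1); lra.
Qed.

(** [chain U a s c]: the list [s] consists of non-overlapping intervals
    [(u, v)], listed from right to left, that lie between [a] and [c] and whose
    half-open versions [`]u, v]] are contained in [U]. *)
Fixpoint chain {R : realType} (U : set R) (a : R) (s : seq (R * R)) (c : R)
    : Prop :=
  if s is uv :: s' then
    [/\ uv.1 <= uv.2, uv.2 <= c, [set` `]uv.1, uv.2]] `<=` U
      & chain U a s' uv.1]
  else a <= c.

Lemma chain_le (R : realType) (U : set R) (a : R) s c c' :
  chain U a s c -> c <= c' -> chain U a s c'.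
Proof.
case: s => [|uv s] /=; first exact: le_trans.
by move=> [? h ? ?] ?; split=> //; apply: le_trans h _.
Qed.

Lemma chain_start (R : realType) (U : set R) (a : R) s c :
  chain U a s c -> a <= c.
Proof.
elim: s c => [|uv s IH] c //= [h1 h2 _ /IH h3].
by apply: le_trans h3 _; apply: le_trans h1 h2.
Qed.

Lemma chain_mem (R : realType) (U : set R) (a : R) s c uv :
  chain U a s c -> uv \in s -> [/\ a <= uv.1, uv.1 <= uv.2 & uv.2 <= c].
Proof.
elim: s c => [|w s IH] c //= [h1 h2 h4 h3]; rewrite inE => /orP[/eqP ->|].
  by split=> //; exact: chain_start h3.
by move=> /(IH _ h3)[? ? h5]; split=> //; apply: le_trans h5 (le_trans h1 h2).
Qed.

Lemma chain_pairwise (R : realType) (U : set R) (a : R) s c :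
  chain U a s c -> pairwise (fun p q : R * R => q.2 <= p.1) s.
Proof.
elim: s c => [|w s IH] c //= [h1 h2 h4 h3]; apply/andP; split; last exact: IH h3.
by apply/allP => uv /(chain_mem h3)[].
Qed.

Lemma chain_measure (R : realType) (U : set R) (a : R) s c : measurable U ->
  chain U a s c ->
  ((\sum_(uv <- s) (uv.2 - uv.1))%:E <=
   @lebesgue_measure R (U `&` [set` `]a, c]]))%E.
Proof.
move=> mU; elim: s c => [|w s IH] c /=; first by rewrite big_nil measure_ge0.
move=> [h1 h2 h4 h3]; have h5 := chain_start h3.
rewrite big_cons addrC EFinD.
apply: (@le_trans _ _ (@lebesgue_measure R
   ((U `&` [set` `]a, w.1]]) `|` [set` `]w.1, w.2]]))); last first.
  apply: le_measure; rewrite ?inE.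
  - by apply: measurableU => //; exact: measurableI.
  - exact: measurableI.
  - move=> x /= [[Ux]|]; rewrite !in_itv/= => /andP[x1 x2].
      by split=> //; rewrite x1/= (le_trans x2)// (le_trans h1).
    split; first by apply: h4; rewrite /= in_itv/= x1.
    by rewrite (le_lt_trans h5)//= (le_trans x2).
rewrite measureU//; last 2 first.
- exact: measurableI.
- rewrite -subset0 => x /= [[_]]; rewrite !in_itv/= => /andP[_ x2] /andP[x3 _].
  by have := lt_le_trans x3 x2; rewrite ltxx.
apply: leeD; first exact: IH.
have mw : ((w.2 - w.1)%:E <= @lebesgue_measure R [set` `]w.1, w.2]])%E.
  rewrite lebesgue_measure_itv/=; case: ifPn => //.
  by rewrite lte_fin -leNgt => h6; rewrite lee_fin subr_le0.
exact: mw.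
Qed.

(** Absolute continuity controls the variation of [f] along the chains inside a
    set of small measure. *)
Lemma abs_continuous_chain (R : realType) (a b e : R) (f : R -> R) :
  0 < e -> abs_continuous a b f ->
  exists2 d, 0 < d & forall U, measurable U ->
    (@lebesgue_measure R U < d%:E)%E -> forall s,
    chain U a s b -> \sum_(uv <- s) `|f uv.2 - f uv.1| < e.
Proof.
move=> e0 /(_ e e0)[d d0 H]; exists d => // U mU Ud s cs.
rewrite (big_nth (0, 0)) big_mkord.
apply: (H (size s) (fun i => (nth (0,0) s i).1) (fun i => (nth (0,0) s i).2)).
- by move=> i; apply: (chain_mem cs); rewrite mem_nth.
- have := chain_pairwise cs => /(pairwiseP (0,0)) pw.
  apply/trivIsetP => i j _ _ ij; rewrite -subset0 => x /=.
  wlog lij : i j ij / (i < j)%N.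
    move=> W; case: (ltngtP i j) => [|h|/ord_inj/eqP]; [exact: W| |by rewrite (negbTE ij)].
    by rewrite eq_sym in ij; case=> ? ?; apply: (W j i).
  have h := pw i j (ltn_ord i) (ltn_ord j) lij.
  rewrite !in_itv/= => -[/andP[h1 _] /andP[_ h2]].
  by have := lt_le_trans h1 (le_trans (ltW h2) h); rewrite ltxx.
- rewrite -[X in X < _](big_mkord xpredT (fun i => (nth (0,0) s i).2 - (nth (0,0) s i).1)).
  rewrite -(big_nth (0, 0) predT (fun uv : R * R => uv.2 - uv.1)) -lte_fin.
  apply: le_lt_trans Ud; apply: le_trans (chain_measure mU cs) _.
  by apply: le_measure; rewrite ?inE//; exact: measurableI.
Qed.

Lemma is_derive0_local (R : realType) (f : R -> R) (t e : R) : 0 < e ->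
  is_derive t 1 f 0 ->
  exists2 d, 0 < d & forall s, `|s - t| < d -> `|f s - f t| <= e * `|s - t|.
Proof.
move=> e0 [df d0].
have : (fun h => h^-1 *: (f (h *: 1 + t) - f t)) @ 0^' --> (0 : R).
  by rewrite -[X in _ --> X]d0; exact: df.
move=> /cvgrPdist_le/(_ _ e0)/nbhs_ballP[d /= dgt0 H].
exists d => // s sd.
have [->|st] := eqVneq s t; first by rewrite !subrr normr0 mulr0.
have := H (s - t); rewrite /ball/= !sub0r !normrN subr_eq0 => /(_ sd st).
rewrite /GRing.scale/= mulr1 subrK normrM normfV.
by rewrite ler_pdivrMl ?normr_gt0 ?subr_eq0// mulrC.
Qed.

(** Let E be the null set of points where the derivative is not known to
    vanish, together with [a] and [b], and let U be an open neighbourhood of E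
    of small measure. Moving from [a] to [b], near a point outside E the
    increment of [f] is at most [e] times the step, and a step around a point
    of E stays inside U, where absolute continuity bounds the total increment
    by [e]. *)
Lemma abs_continuous_derive0 (R : realType) (a b : R) (f : R -> R) : a <= b ->
  abs_continuous a b f ->
  {ae (@lebesgue_measure R), forall t, a < t < b -> is_derive t 1 f 0} ->
  f b = f a.
Proof.
move=> ab acf [N [mN N0 subN]].
pose E := N `|` [set a] `|` [set b].
have mE : measurable E by apply: measurableU => //; apply: measurableU.
have E0 : @lebesgue_measure R E = 0%E.
  rewrite !measureU0//; last 2 first.
  - exact: measurableU.
  - exact: lebesgue_measure_set1.
  exact: lebesgue_measure_set1.
suff H e : 0 < e -> `|f b - f a| <= e * (b - a) + e.
  apply/eqP; rewrite -subr_eq0 -normr_le0; apply/ler_addgt0Pl => e e0.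
  rewrite addr0.
  have h1 : 0 < b - a + 1 by lra.
  have := H (e / (b - a + 1)) (divr_gt0 e0 h1).
  suff -> : e / (b - a + 1) * (b - a) + e / (b - a + 1) = e by [].
  by field; rewrite lt0r_neq0.
move=> e0.
have [d d0 Hd] := abs_continuous_chain e0 acf.
have [U [oU EU]] : exists U, [/\ open U, E `<=` U & (@lebesgue_measure R U < d%:E)%E].
  have [|U [oU EU UE]] := @lebesgue_regularity_outer R E d mE _ d0.
    by rewrite [X in (X < _)%E]E0 ltry.
  exists U; split=> //.
  have -> : U = (U `\` E) `|` E by rewrite setUC setDUK.
  have mUE : measurable (U `\` E) by apply: measurableD => //; exact: measurable_realfun.open_measurable.
  by rewrite measureU0.
move=> Ud; have mU := measurable_realfun.open_measurable oU.
suff [s [cs hs]] : exists s, chain U a s b /\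
    `|f b - f a| <= e * (b - a) + \sum_(uv <- s) `|f uv.2 - f uv.1|.
  by apply: le_trans hs _; rewrite lerD2l ltW// (Hd U).
apply: (@interval_induction R a b (fun c => exists s, chain U a s c /\
    `|f c - f a| <= e * (c - a) + \sum_(uv <- s) `|f uv.2 - f uv.1|)) => //.
  by exists [::]; rewrite /= big_nil !subrr normr0 mulr0 addr0.
move=> t /andP[at_ tb].
have [/EU Ut|nEt] := pselect (E t).
  have /nbhs_ballP[h /= h0 hU] : nbhs t U by apply: open_nbhs_nbhs.
  exists h => // u v au /andP[ut tv] vb hu hv [s [cs hs]].
  have uv := le_trans ut tv.
  exists ((u, v) :: s); split.
    split=> //= x /=; rewrite in_itv/= => /andP[x1 x2]; apply: hU.
    by rewrite /ball/= ltr_distlC; apply/andP; split; lra.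
  rewrite big_cons /=.
  have -> : f v - f a = (f v - f u) + (f u - f a) by ring.
  apply: le_trans (ler_normD _ _) _.
  have : e * (u - a) <= e * (v - a) by rewrite ler_pM2l//; lra.
  by move: hs; lra.
have dt : is_derive t 1 f 0.
  apply: contrapT => nd; apply: nEt.
  have [->|ta] := eqVneq t a; first by left; right.
  have [->|tb'] := eqVneq t b; first by right.
  left; left; apply: subN => /= H; apply: nd; apply: H.
  by rewrite !lt_neqAle eq_sym ta tb' at_ tb.
have [h h0 hf] := is_derive0_local e0 dt.
exists h => // u v au /andP[ut tv] vb hu hv [s [cs hs]].
exists s; split; first exact: chain_le cs (le_trans ut tv).
have fu : `|f u - f t| <= e * (t - u).
  have := hf u; rewrite distrC (ger0_norm (x := t - u)) ?subr_ge0//.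
  by apply; lra.
have fv : `|f v - f t| <= e * (v - t).
  have := hf v; rewrite (ger0_norm (x := v - t)) ?subr_ge0//.
  by apply; lra.
have -> : f v - f a = (f v - f t) - (f u - f t) + (f u - f a) by ring.
apply: le_trans (ler_normD _ _) _.
have := ler_normB (f v - f t) (f u - f t).
by move: fu fv hs; lra.
Qed.

Lemma abs_continuousW (R : realType) (a b a' b' : R) (f : R -> R) :
  a <= a' -> b' <= b -> abs_continuous a b f -> abs_continuous a' b' f.
Proof.
move=> aa bb acf e e0; have [d d0 H] := acf e e0.
exists d => // n u v uv; apply: H => i; have [h1 h2 h3] := uv i.
by split=> //; [exact: le_trans h1|exact: le_trans h3 _].
Qed.

Lemma abs_continuous_lin (R : realType) (a b k m : R) (f g : R -> R) :
  abs_continuous a b f -> abs_continuous a b g ->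
  abs_continuous a b (fun t => k * f t + m * g t).
Proof.
move=> acf acg e e0.
pose K := `|k| + `|m| + 1.
have K0 : 0 < K by rewrite /K; have := normr_ge0 k; have := normr_ge0 m; lra.
have [d d0 Hf] := acf (e / K) (divr_gt0 e0 K0).
have [d' d'0 Hg] := acg (e / K) (divr_gt0 e0 K0).
exists (Num.min d d'); first by rewrite lt_min d0.
move=> n u v uv tI; rewrite lt_min => /andP[h1 h2].
have {}Hf := Hf n u v uv tI h1; have {}Hg := Hg n u v uv tI h2.
set X := \sum_(i < n) _ in Hf; set Y := \sum_(i < n) _ in Hg.
apply: (@le_lt_trans _ _ (`|k| * X + `|m| * Y)).
  rewrite /X /Y !mulr_sumr -big_split/=; apply: ler_sum => i _.
  rewrite -!normrM; apply: le_trans (ler_normD _ _).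
  by rewrite le_eqVlt; apply/orP; left; apply/eqP; congr (`|_|); ring.
have -> : e = K * (e / K) by rewrite mulrC divfK// lt0r_neq0.
set q := e / K in Hf Hg *; have q0 : 0 < q by apply: divr_gt0.
have := ler_wpM2l (normr_ge0 k) (ltW Hf); have := ler_wpM2l (normr_ge0 m) (ltW Hg).
by rewrite /K; lra.
Qed.

Lemma abs_continuous_id (R : realType) (a b : R) : abs_continuous a b id.
Proof.
move=> e e0; exists e => // n u v uv _; apply: le_lt_trans.
by apply: ler_sum => i _; rewrite ger0_norm// subr_ge0; case: (uv i).
Qed.

Lemma abs_continuous_derive_cst (R : realType) (a b k : R) (f : R -> R) :
  a <= b -> abs_continuous a b f ->
  {ae (@lebesgue_measure R), forall t, a < t < b -> is_derive t 1 f k} ->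
  f b = f a + k * (b - a).
Proof.
move=> ab acf df.
have := @abs_continuous_derive0 R a b (fun t => 1 * f t + (- k) * id t) ab.
move=> /(_ _ _)/= H; have {H} : 1 * f b + - k * b = 1 * f a + - k * a; last by lra.
apply: H; first by apply: abs_continuous_lin acf _; exact: abs_continuous_id.
apply: negligibleS df => t /=; apply: contra_not => H /H dt.
by apply: is_derive_eq; rewrite /GRing.scale/=; ring.
Qed.

(** * One piece of the Hamiltonian *)

(** The component of the row [(f, g)] along [(cos th, sin th)]. *)
Definition along (R : realType) (th : R) (f g : R -> R) (t : R) : R :=
  cos th * f t + sin th * g t.

(** The component of the row [(f, g)] along [(- sin th, cos th)]. *)
Definition across (R : realType) (th : R) (f g : R -> R) (t : R) : R :=
  - sin th * f t + cos th * g t.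

Lemma along_rotate (R : realType) (th th' : R) (f g : R -> R) (t : R) :
  along th' f g t
  = cos (th' - th) * along th f g t + sin (th' - th) * across th f g t.
Proof.
rewrite -{1}(subrK th th'); move: (th' - th) => w.
by rewrite /along /across cosD sinD; ring.
Qed.

Lemma across_rotate (R : realType) (th th' : R) (f g : R -> R) (t : R) :
  across th' f g t
  = cos (th' - th) * across th f g t - sin (th' - th) * along th f g t.
Proof.
rewrite -{1}(subrK th th'); move: (th' - th) => w.
by rewrite /along /across cosD sinD; ring.
Qed.

Lemma ae_derive_sub (R : realType) (x y x' y' : R) (P : R -> Prop) :
  x <= x' -> y' <= y ->
  {ae (@lebesgue_measure R), forall t, x < t < y -> P t} ->
  {ae (@lebesgue_measure R), forall t, x' < t < y' -> P t}.
Proof.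
move=> xx yy; apply: negligibleS => t /=; apply: contra_not => H /andP[h1 h2].
by apply: H; rewrite (le_lt_trans xx h1) (lt_le_trans h2 yy).
Qed.

(** The canonical system with angle [th] and [z = ir], at the point [t], for the
    row [(a + ib, c + id)]. Written in real and imaginary parts, it says that
    the derivative of the row is [z p (- sin th, cos th)], where [p] is the
    component of the row along [(cos th, sin th)]. *)
Definition row_system (R : realType) (r th : R) (a b c d : R -> R) (t : R) :=
  [/\ is_derive t 1 a (r * sin th * along th b d t),
      is_derive t 1 b (- (r * sin th * along th a c t)),
      is_derive t 1 c (- (r * cos th * along th b d t))
    & is_derive t 1 d (r * cos th * along th a c t)].

Lemma row_system_along (R : realType) (x y r th : R) (a b c d : R -> R) :
  x <= y -> abs_continuous x y a -> abs_continuous x y b ->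
  abs_continuous x y c -> abs_continuous x y d ->
  {ae (@lebesgue_measure R), forall t, x < t < y -> row_system r th a b c d t} ->
  along th a c y = along th a c x /\ along th b d y = along th b d x.
Proof.
move=> xy aca acb acc acd de; split.
  rewrite (@abs_continuous_derive0 R x y (along th a c))//.
    exact: abs_continuous_lin.
  apply: negligibleS de => t /=; apply: contra_not => H /H[? ? ? ?].
  by apply: is_derive_eq; rewrite /GRing.scale/=; ring.
rewrite (@abs_continuous_derive0 R x y (along th b d))//.
  exact: abs_continuous_lin.
apply: negligibleS de => t /=; apply: contra_not => H /H[? ? ? ?].
by apply: is_derive_eq; rewrite /GRing.scale/=; ring.
Qed.

Lemma row_system_across (R : realType) (x y r th : R) (a b c d : R -> R) :
  x <= y -> abs_continuous x y a -> abs_continuous x y b ->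
  abs_continuous x y c -> abs_continuous x y d ->
  {ae (@lebesgue_measure R), forall t, x < t < y -> row_system r th a b c d t} ->
  across th a c y = across th a c x - r * along th b d x * (y - x) /\
  across th b d y = across th b d x + r * along th a c x * (y - x).
Proof.
move=> xy aca acb acc acd de.
have cst t : x < t < y ->
    along th a c t = along th a c x /\ along th b d t = along th b d x.
  move=> /andP[/ltW xt /ltW ty].
  have W f : abs_continuous x y f -> abs_continuous x t f.
    exact: abs_continuousW.
  apply: (@row_system_along R x t r th a b c d) => //; try exact: W.
  exact: ae_derive_sub de.
split.
  rewrite -mulNr; apply: (@abs_continuous_derive_cst R x y _ (across th a c)) => //.
    exact: abs_continuous_lin.
  apply: negligibleS de => t /=; apply: contra_not => H xty.
  have [? ? ? ?] := H xty; have [_ <-] := cst t xty.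
  apply: is_derive_eq; rewrite /GRing.scale/=.
  by rewrite -[RHS]mulr1 -(cos2Dsin2 th); ring.
apply: (@abs_continuous_derive_cst R x y _ (across th b d)) => //.
  exact: abs_continuous_lin.
apply: negligibleS de => t /=; apply: contra_not => H xty.
have [? ? ? ?] := H xty; have [<- _] := cst t xty.
apply: is_derive_eq; rewrite /GRing.scale/=.
by rewrite -[RHS]mulr1 -(cos2Dsin2 th); ring.
Qed.

(** The weighted norm [|p| + rho |q|] of the row [(a + ib, c + id)], where [p]
    and [q] are its components along and across the angle [th]. The modulus of
    a complex number is replaced by the sum of the absolute values of its real
    and imaginary parts, which is compatible with multiplication by reals and
    by the imaginary unit. *)
Definition wnorm (R : realType) (rho th : R) (a b c d : R -> R) (t : R) : R :=
  `|along th a c t| + `|along th b d t|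
  + rho * (`|across th a c t| + `|across th b d t|).

Lemma wnorm_ge0 (R : realType) (rho th : R) (a b c d : R -> R) t : 0 <= rho ->
  0 <= wnorm rho th a b c d t.
Proof. by move=> h; rewrite !addr_ge0 ?mulr_ge0 ?addr_ge0 ?normr_ge0. Qed.

Lemma wnorm_piece (R : realType) (x y r rho th : R) (a b c d : R -> R) :
  0 <= r -> 0 <= rho ->
  x <= y -> abs_continuous x y a -> abs_continuous x y b ->
  abs_continuous x y c -> abs_continuous x y d ->
  {ae (@lebesgue_measure R), forall t, x < t < y -> row_system r th a b c d t} ->
  wnorm rho th a b c d y <= (1 + rho * r * (y - x)) * wnorm rho th a b c d x.
Proof.
move=> r0 rho0 xy aca acb acc acd de; rewrite /wnorm.
have [-> ->] := row_system_along xy aca acb acc acd de.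
have [-> ->] := row_system_across xy aca acb acc acd de.
set p := along th a c x; set q := along th b d x.
set u := across th a c x; set v := across th b d x.
have xy0 : 0 <= y - x by rewrite subr_ge0.
have h1 : `|u - r * q * (y - x)| <= `|u| + r * `|q| * (y - x).
  by rewrite (le_trans (ler_normB _ _))// !normrM (ger0_norm r0) (ger0_norm xy0).
have h2 : `|v + r * p * (y - x)| <= `|v| + r * `|p| * (y - x).
  by rewrite (le_trans (ler_normD _ _))// !normrM (ger0_norm r0) (ger0_norm xy0).
have h3 := ler_wpM2l rho0 (lerD h1 h2).
have h4 : 0 <= rho * r * (y - x) * (rho * (`|u| + `|v|)).
  by rewrite !mulr_ge0// addr_ge0.
by move: h3 h4; lra.
Qed.

Lemma wnorm_rotate (R : realType) (rho th th' : R) (a b c d : R -> R) (t : R) :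
  0 < rho -> rho <= 1 ->
  wnorm rho th' a b c d t
  <= (1 + `|sin (th' - th)| / rho) * wnorm rho th a b c d t.
Proof.
move=> rho0 rho1; rewrite /wnorm.
have hp f g : `|along th' f g t| <=
    `|along th f g t| + `|sin (th' - th)| * `|across th f g t|.
  rewrite (along_rotate th) (le_trans (ler_normD _ _))// !normrM lerD2r.
  by rewrite ler_piMl// ler_norml cos_geN1 cos_le1.
have hq f g : `|across th' f g t| <=
    `|across th f g t| + `|sin (th' - th)| * `|along th f g t|.
  rewrite (across_rotate th) (le_trans (ler_normB _ _))// !normrM lerD2r.
  by rewrite ler_piMl// ler_norml cos_geN1 cos_le1.
have h1 := lerD (hp a c) (hp b d).
have h2 := ler_wpM2l (ltW rho0) (lerD (hq a c) (hq b d)).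
set s := `|sin _| in h1 h2 *.
have s0 : 0 <= s by exact: normr_ge0.
set p := `|along th a c t| in h1 h2 *; set q := `|along th b d t| in h1 h2 *.
set u := `|across th a c t| in h1 h2 *; set v := `|across th b d t| in h1 h2 *.
have h3 : rho * (s * (p + q)) <= s / rho * (p + q).
  rewrite mulrA ler_wpM2r ?addr_ge0 ?normr_ge0// mulrC ler_wpM2l//.
  by rewrite (le_trans rho1)// invf_ge1.
have h4 : s / rho * (rho * (u + v)) = s * (u + v).
  by rewrite mulrA divfK// lt0r_neq0.
rewrite mulrDl mul1r (mulrDr (s / rho)) h4.
by move: h1 h2 h3; lra.
Qed.

(** * Tail sums and nodes *)

Lemma sum_nat_ge0 (R : realType) (u : nat -> R) (m n : nat) :
  (forall j, (0 < j)%N -> 0 <= u j) -> 0 <= \sum_(m.+1 <= j < n) u j.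
Proof.
move=> u0; rewrite big_seq sumr_ge0// => j; rewrite mem_index_iota => /andP[h _].
by apply: u0; apply: leq_trans h.
Qed.

Lemma partial_sum_nondecreasing (R : realType) (u : nat -> R) (N : nat) :
  (forall j, (0 < j)%N -> 0 <= u j) ->
  nondecreasing_seq (fun n => \sum_(N.+1 <= j < n) u j).
Proof.
move=> u0 m n mn; have [mN|Nm] := leqP m N.+1.
  by rewrite [X in X <= _]big_geq// sum_nat_ge0.
rewrite [X in _ <= X](big_cat_nat (n := m))//=; last exact: ltnW.
by rewrite lerDl; case: m Nm {mn} => // m _; exact: sum_nat_ge0.
Qed.

Lemma sum_nat_shift_le (R : realType) (u : nat -> R) (N n : nat) :
  (forall j, (0 < j)%N -> 0 <= u j) ->
  \sum_(N.+1 <= j < n) u j <= \sum_(1 <= j < n) u j.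
Proof.
move=> u0; have [nN|Nn] := leqP n N.+1.
  by rewrite [X in X <= _]big_geq// sum_nat_ge0.
rewrite [X in _ <= X](big_cat_nat (n := N.+1))//=; last exact: ltnW.
by rewrite lerDr sum_nat_ge0.
Qed.

Lemma sum_le_tail_sum (R : realType) (u : nat -> R) (N n : nat) :
  (forall j, (0 < j)%N -> 0 <= u j) ->
  cvgn (fun n : nat => \sum_(1 <= j < n) u j) ->
  \sum_(N.+1 <= j < n) u j <= tail_sum u N.
Proof.
move=> u0 cu; apply: (nondecreasing_cvgn_le (@partial_sum_nondecreasing R u N u0)).
apply: nondecreasing_is_cvgn; first exact: partial_sum_nondecreasing.
exists (tail_sum u 0) => _ [k _ <-].
apply: le_trans (sum_nat_shift_le N k u0) _.
exact: (nondecreasing_cvgn_le (@partial_sum_nondecreasing R u 0 u0) cu).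
Qed.

Lemma tail_sum_ge0 (R : realType) (u : nat -> R) (N : nat) :
  (forall j, (0 < j)%N -> 0 <= u j) ->
  cvgn (fun n : nat => \sum_(1 <= j < n) u j) -> 0 <= tail_sum u N.
Proof.
by move=> u0 cu; apply: le_trans (sum_le_tail_sum N 0 u0 cu); exact: sum_nat_ge0.
Qed.

Lemma tail_sum_le (R : realType) (u : nat -> R) (N : nat) :
  (forall j, (0 < j)%N -> 0 <= u j) ->
  cvgn (fun n : nat => \sum_(1 <= j < n) u j) -> tail_sum u N <= tail_sum u 0.
Proof.
move=> u0 cu; apply: limr_le.
  apply: nondecreasing_is_cvgn; first exact: partial_sum_nondecreasing.
  exists (tail_sum u N) => _ [k _ <-]; exact: sum_le_tail_sum.
apply: nearW => n; apply: le_trans (sum_nat_shift_le N n u0) _.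
exact: sum_le_tail_sum.
Qed.

Lemma node0 (R : realType) (l : nat -> R) : node l 0 = 0.
Proof. by rewrite /node big_geq. Qed.

Lemma nodeS (R : realType) (l : nat -> R) n : node l n.+1 = node l n + l n.+1.
Proof. by rewrite /node big_nat_recr. Qed.

Lemma node_nondecreasing (R : realType) (l : nat -> R) :
  (forall j, (0 < j)%N -> 0 < l j) -> nondecreasing_seq (node l).
Proof.
move=> l0; apply/nondecreasing_seqP => n.
by rewrite nodeS lerDl ltW// l0.
Qed.

Lemma piece_eq (R : realType) (l : nat -> R) (n : nat) (t : R) :
  (forall j, (0 < j)%N -> 0 < l j) -> node l n <= t < node l n.+1 ->
  piece l t = n.+1.
Proof.
move=> l0 /andP[t1 t2]; apply: xget_unique; first by rewrite /= t1.
case=> [[]//|m] [_ /= /andP[t3 t4]]; congr _.+1; apply/eqP.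
rewrite eqn_leq; apply/andP; split; rewrite leqNgt; apply/negP => h.
  by have := node_nondecreasing l0 h; rewrite leNgt (le_lt_trans t3 t2).
by have := node_nondecreasing l0 h; rewrite leNgt (le_lt_trans t1 t4).
Qed.

(** * From the matrix system to its second row *)

Lemma mul_Jmx0 (R : realType) (A : 'M[R[i]]_2) : (A *m Jmx R[i]) 1 0 = A 1 1.
Proof.
by rewrite !mxE !big_ord_recl big_ord0 !mxE /= mulr0 mulr1 add0r addr0;
   congr (A _ _); apply/val_inj.
Qed.

Lemma mul_Jmx1 (R : realType) (A : 'M[R[i]]_2) : (A *m Jmx R[i]) 1 1 = - A 1 0.
Proof.
by rewrite !mxE !big_ord_recl big_ord0 !mxE /= mulr0 mulrN1 !addr0;
   congr (- A _ _); apply/val_inj.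
Qed.

Lemma mul_hamiltonian (R : realType) (l phi : nat -> R) (t : R) (z : R[i])
    (A : 'M[R[i]]_2) (k : 'I_2) :
  let th := phi (piece l t) in
  (z *: (A *m map_mx (real_complex R) (hamiltonian l phi t))) 1 k
  = z * (A 1 0 * real_complex R (cos th) + A 1 1 * real_complex R (sin th))
      * real_complex R (if k == 0 then cos th else sin th).
Proof.
rewrite !mxE !big_ord_recl big_ord0 !mxE !big_ord_recl !big_ord0 !mxE /=.
rewrite !addr0 !rmorphM/=.
have -> : lift ord0 ord0 = 1 :> 'I_2 by apply/val_inj.
have -> : ord0 = 0 :> 'I_2 by apply/val_inj.
by case: (k == 0); ring.
Qed.

(** The real and imaginary parts of the second row of a fundamental solution
    solve [row_system] almost everywhere, with the angle of the current
    piece. *)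
Lemma fundamental_solution_row (R : realType) (L r : R) (l phi : nat -> R)
    (W : R -> 'M[R[i]]_2) :
  is_fundamental_solution L (hamiltonian l phi) (Complex 0 r) W ->
  {ae (@lebesgue_measure R), forall t, 0 < t < L ->
     row_system r (phi (piece l t))
       (fun s => complex.Re (W s 1 0)) (fun s => complex.Im (W s 1 0))
       (fun s => complex.Re (W s 1 1)) (fun s => complex.Im (W s 1 1)) t}.
Proof.
move=> [_ _ dW]; apply: negligibleS dW => t /=; apply: contra_not => H /H{}H.
have [] := H 1 0; have [] := H 1 1.
rewrite !mul_hamiltonian /=.
have -> : (fun s => complex.Re ((W s *m Jmx R[i]) 1 0)) =
          (fun s => complex.Re (W s 1 1)).
  by apply/funext => s; rewrite mul_Jmx0.
have -> : (fun s => complex.Im ((W s *m Jmx R[i]) 1 0)) =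
          (fun s => complex.Im (W s 1 1)).
  by apply/funext => s; rewrite mul_Jmx0.
have -> : (fun s => complex.Re ((W s *m Jmx R[i]) 1 1)) =
          - (fun s => complex.Re (W s 1 0)).
  by apply/funext => s; rewrite mul_Jmx1 /= raddfN.
have -> : (fun s => complex.Im ((W s *m Jmx R[i]) 1 1)) =
          - (fun s => complex.Im (W s 1 0)).
  by apply/funext => s; rewrite mul_Jmx1 /= raddfN.
move=> /is_deriveN; rewrite opprK => da /is_deriveN; rewrite opprK => db dc dd.
rewrite /row_system /along.
case: (W t 1 0) (W t 1 1) da db dc dd => a b [c d] /= da db dc dd.
by split; [apply: is_derive_eq da _|apply: is_derive_eq db _
  |apply: is_derive_eq dc _|apply: is_derive_eq dd _]; ring.
Qed.

(** * Growth of the row *)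

(** One interval followed by the change to the next angle. *)
Lemma wnorm_step (R : realType) (l phi : nat -> R) (r rho L : R)
    (a b c d : R -> R) (n : nat) :
  (forall j, (0 < j)%N -> 0 < l j) -> 0 <= r -> 0 < rho -> rho <= 1 ->
  node l n.+1 <= L ->
  abs_continuous 0 L a -> abs_continuous 0 L b ->
  abs_continuous 0 L c -> abs_continuous 0 L d ->
  {ae (@lebesgue_measure R), forall t, 0 < t < L ->
     row_system r (phi (piece l t)) a b c d t} ->
  wnorm rho (phi n.+2) a b c d (node l n.+1)
  <= (1 + `|sin (phi n.+2 - phi n.+1)| / rho) * (1 + rho * r * l n.+1)
     * wnorm rho (phi n.+1) a b c d (node l n).
Proof.
move=> l0 r0 rho0 rho1 nL aca acb acc acd de.
apply: le_trans (wnorm_rotate (phi n.+1) _ _ _ _ _ _ rho0 rho1) _.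
rewrite -mulrA ler_wpM2l ?addr_ge0 ?divr_ge0 ?normr_ge0 ?(ltW rho0)//.
have x0 : 0 <= node l n by rewrite -(node0 l); exact: node_nondecreasing.
have W f : abs_continuous 0 L f -> abs_continuous (node l n) (node l n.+1) f.
  exact: abs_continuousW.
have xy : node l n <= node l n.+1 by exact: node_nondecreasing.
have -> : l n.+1 = node l n.+1 - node l n by rewrite nodeS addrC addKr.
apply: (wnorm_piece r0 (ltW rho0) xy); try exact: W.
move/ae_derive_sub : de => /(_ _ _ x0 nL); apply: negligibleS => t /=.
apply: contra_not => H xty; have := H xty; rewrite (@piece_eq R l n t)//.
by case/andP: xty => /ltW-> ->.
Qed.

(** The two terms balance at [rho = sqrt (S / (r La))]. If this exceeds 1 then
    [rho = 1] is good enough, and if it is so small that even [r S <= La] then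
    [rho = 1 / r] is. The lower bound [1 / r] keeps the cost of the change of
    weight polynomial in [r]. *)
Lemma optimal_weight (R : realType) (r S La : R) : 1 <= r -> 0 <= S -> 0 <= La ->
  exists rho, [/\ 0 < rho, r^-1 <= rho, rho <= 1 &
    S / rho + rho * r * La <= 2 * Num.sqrt (r * La * S) + 2 * La + 2 * S].
Proof.
move=> r1 S0 La0; have r0 : 0 < r by lra.
have q0 := sqrtr_ge0 (r * La * S).
have ri1 : r^-1 <= 1 by rewrite invf_le1.
(* The balance point is at least 1. *)
have [h1|h1] := leP (r * La) S.
  by exists 1; split=> //; rewrite ?ltr01// divr1 mul1r; lra.
have [h2|h2] := leP (r * S) La.
  exists r^-1; split; rewrite ?invr_gt0// invrK mulVf ?mul1r ?lt0r_neq0//.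
  by rewrite (mulrC S); lra.
have S1 : 0 < S by rewrite -(pmulr_rgt0 _ r0) (le_lt_trans La0).
have y0 : 0 < r * La by apply: lt_trans h1.
have x0 : 0 < Num.sqrt S by rewrite sqrtr_gt0.
have z0 : 0 < Num.sqrt (r * La) by rewrite sqrtr_gt0.
exists (Num.sqrt S / Num.sqrt (r * La)); split.
- exact: divr_gt0.
- rewrite ler_pdivlMr// mulrC ler_pdivrMr// -(ler_pXn2r (n := 2))//; last 2 first.
  + by rewrite nnegrE ltW.
  + by rewrite nnegrE mulr_ge0// ltW.
  rewrite exprMn (sqr_sqrtr S0) (sqr_sqrtr (ltW y0)).
  have := ler_wpM2l (ltW r0) (ltW h2); by rewrite mulrA -expr2 (mulrC (r ^+ 2)).
- by rewrite ler_pdivrMr// mul1r ler_sqrt ltW.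
- rewrite (sqrtrM _ (ltW y0)).
  have e1 : S / (Num.sqrt S / Num.sqrt (r * La)) = Num.sqrt (r * La) * Num.sqrt S.
    rewrite -{1}(sqr_sqrtr S0); field; rewrite !lt0r_neq0//.
  have e2 : Num.sqrt S / Num.sqrt (r * La) * r * La = Num.sqrt (r * La) * Num.sqrt S.
    rewrite -mulrA -{2}(sqr_sqrtr (ltW y0)); field; rewrite lt0r_neq0//.
  by rewrite e1 e2; lra.
Qed.

(** * The choice of the number of pieces *)

Lemma lower_inverse_spec (R : realType) (G : nat -> R) (x : R) :
  (exists N, (0 < N)%N /\ G N < x) ->
  (0 < lower_inverse G x)%N /\ G (lower_inverse G x) < x.
Proof.
move=> [N [N0 GN]]; rewrite /lower_inverse.
have ex : exists N, (0 < N)%N && `[<G N < x>].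
  by exists N; rewrite N0; exact/asboolP.
have [M /andP[M0 /asboolP GM] minM] := ex_minnP ex.
have : [set N | [/\ (0 < N)%N, G N < x &
    forall M, (0 < M)%N -> G M < x -> (N <= M)%N]] M.
  by split=> // K K0 GK; apply: minM; rewrite K0; exact/asboolP.
by move=> /(xgetI 0%N)[].
Qed.

(** [Gfun l phi N] is at most a constant over [N], hence tends to 0. *)
Lemma Gfun_lt (R : realType) (l phi : nat -> R) (x : R) : 0 < x ->
  (forall j, (0 < j)%N -> 0 < l j) ->
  cvgn (fun n : nat => \sum_(1 <= j < n) l j) ->
  cvgn (fun n : nat => \sum_(1 <= j < n) `|sin (phi j.+1 - phi j)|) ->
  exists N, (0 < N)%N /\ Gfun l phi N < x.
Proof.
move=> x0 l0 cl cs.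
set K := Num.sqrt (tail_sum l 0) * Num.sqrt (tail_sum (fun j => `|sin (phi j.+1 - phi j)|) 0).
have K0 : 0 <= K by rewrite mulr_ge0.
exists (Num.truncn (K / x)).+1; split=> //; rewrite /Gfun -mulrA.
rewrite mulrC ltr_pdivrMr ?ltr0Sn//.
apply: (@le_lt_trans _ _ K).
  apply: ler_pM => //; apply: ler_wsqrtr; apply: tail_sum_le => // j j0; exact/ltW/l0.
rewrite mulrC -ltr_pdivrMr//; exact: truncnS_gt.
Qed.

(** * The bound at the end of the interval *)

Lemma normc_le (R : realType) (w : R[i]) :
  complex.ComplexField.Normc.normc w <= `|complex.Re w| + `|complex.Im w|.
Proof.
case: w => a b /=; rewrite -[leRHS]ger0_norm ?addr_ge0// -sqrtr_sqr.
apply: ler_wsqrtr; rewrite -(real_normK (num_real a)) -(real_normK (num_real b)).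
have := mulr_ge0 (normr_ge0 a) (normr_ge0 b); nra.
Qed.

Lemma abs_continuous_cvg_end (R : realType) (L : R) (f : R -> R) (x : nat -> R) :
  abs_continuous 0 L f -> (forall n, 0 <= x n <= L) ->
  x n @[n --> \oo] --> L -> f (x n) @[n --> \oo] --> f L.
Proof.
move=> acf xL cx; apply/cvgrPdist_lt => e e0.
have [d d0 H] := acf e e0.
near=> n.
have h : `|L - x n| < d by near: n; move/cvgrPdist_lt: cx; exact.
have /andP[h1 h2] := xL n.
have := H 1%N (fun=> x n) (fun=> L); rewrite !big_ord1; apply.
- by split.
- by apply/trivIsetP => i j _ _; rewrite !ord1 eqxx.
- by rewrite -(ger0_norm (x := L - x n))// subr_ge0.
Unshelve. all: by end_near. Qed.

(** Growth of the weighted norm from node [m] to node [n]. *)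
Lemma row_growth (R : realType) (l phi : nat -> R) (r rho L : R)
    (a b c d : R -> R) (m n : nat) :
  (forall j, (0 < j)%N -> 0 < l j) -> (forall n, node l n <= L) ->
  0 <= r -> 0 < rho -> rho <= 1 ->
  abs_continuous 0 L a -> abs_continuous 0 L b ->
  abs_continuous 0 L c -> abs_continuous 0 L d ->
  {ae (@lebesgue_measure R), forall t, 0 < t < L ->
     row_system r (phi (piece l t)) a b c d t} -> (m <= n)%N ->
  wnorm rho (phi n.+1) a b c d (node l n)
  <= expR ((\sum_(m.+1 <= j < n.+1) `|sin (phi j.+1 - phi j)|) / rho
           + rho * r * \sum_(m.+1 <= j < n.+1) l j)
     * wnorm rho (phi m.+1) a b c d (node l m).
Proof.
move=> l0 nL r0 rho0 rho1 aca acb acc acd de.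
elim: n => [|n IH].
  rewrite leqn0 => /eqP ->.
  by rewrite !big_geq// mul0r mulr0 addr0 expR0 mul1r.
rewrite leq_eqVlt => /orP[/eqP ->|].
  by rewrite !big_geq// mul0r mulr0 addr0 expR0 mul1r.
rewrite ltnS => mn.
have E (u : nat -> R) :
    \sum_(m.+1 <= j < n.+2) u j = \sum_(m.+1 <= j < n.+1) u j + u n.+1.
  by rewrite big_nat_recr.
rewrite !E.
apply: le_trans (wnorm_step l0 r0 rho0 rho1 (nL n.+1) aca acb acc acd de) _.
set s := `|sin _|; set X := \sum_(_ <= _ < _) _; set Y := \sum_(_ <= _ < _) _.
have -> : (X + s) / rho + rho * r * (Y + l n.+1) =
  (s / rho + rho * r * l n.+1) + (X / rho + rho * r * Y) by ring.
rewrite expRD expRD -[leRHS]mulrA.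
have h1 := expR_ge1Dx (s / rho); have h2 := expR_ge1Dx (rho * r * l n.+1).
have p1 : 0 <= s / rho by rewrite divr_ge0 ?normr_ge0 ?(ltW rho0).
have p2 : 0 <= rho * r * l n.+1 by rewrite !mulr_ge0//; [exact: ltW|exact/ltW/l0].
have q1 : 0 <= 1 + s / rho by rewrite addr_ge0.
have q2 : 0 <= 1 + rho * r * l n.+1 by rewrite addr_ge0.
apply: ler_pM; [exact: mulr_ge0|exact/wnorm_ge0/ltW|exact: ler_pM|exact: IH].
Qed.

(** With weight 1, the factor [1 + r l_j] is bounded by [1 + r L], and this by
    [expR (ln r + L)]. *)
Lemma row_growth_crude (R : realType) (l phi : nat -> R) (r L : R)
    (a b c d : R -> R) (n : nat) :
  (forall j, (0 < j)%N -> 0 < l j) -> (forall n, node l n <= L) -> 1 <= r ->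
  abs_continuous 0 L a -> abs_continuous 0 L b ->
  abs_continuous 0 L c -> abs_continuous 0 L d ->
  {ae (@lebesgue_measure R), forall t, 0 < t < L ->
     row_system r (phi (piece l t)) a b c d t} ->
  wnorm 1 (phi n.+1) a b c d (node l n)
  <= expR (\sum_(1 <= j < n.+1) `|sin (phi j.+1 - phi j)| + n%:R * (ln r + L))
     * wnorm 1 (phi 1%N) a b c d 0.
Proof.
move=> l0 nL r1 aca acb acc acd de.
have r0 : 0 < r by lra.
elim: n => [|n IH].
  by rewrite node0 big_geq// mul0r addr0 expR0 mul1r.
rewrite big_nat_recr//=.
apply: le_trans (wnorm_step l0 (ltW r0) ltr01 (lexx _) (nL n.+1) aca acb acc acd de) _.
set s := `|sin _|; set X := \sum_(_ <= _ < _) _.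
have -> : X + s + n.+1%:R * (ln r + L) = s + (ln r + L) + (X + n%:R * (ln r + L)).
  by rewrite -natr1; ring.
rewrite divr1 mul1r expRD -[leRHS]mulrA.
have s0 : 0 <= s by exact: normr_ge0.
have ln0 : 0 < l n.+1 by exact: l0.
have lL : l n.+1 <= L.
  apply: le_trans (nL n.+1); rewrite nodeS lerDr -(node0 l).
  exact: node_nondecreasing.
have q1 : 0 <= 1 + s by rewrite addr_ge0.
have q2 : 0 <= 1 + r * l n.+1 by rewrite addr_ge0// mulr_ge0// ltW.
apply: ler_pM => //; [exact: mulr_ge0|exact: wnorm_ge0|].
rewrite expRD; apply: ler_pM => //; first exact: expR_ge1Dx.
rewrite expRD lnK ?posrE//.
apply: (@le_trans _ _ (r * (1 + L))); last by rewrite ler_pM2l// expR_ge1Dx.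
by rewrite mulrDr mulr1 lerD// ler_pM2l.
Qed.

Lemma last_entry_le_wnorm (R : realType) (rho th : R) (a b c d : R -> R) (t : R) :
  0 < rho -> rho <= 1 -> `|c t| + `|d t| <= wnorm rho th a b c d t / rho.
Proof.
move=> rho0 rho1.
have H f g : `|g t| <= `|along th f g t| + `|across th f g t|.
  have -> : g t = sin th * along th f g t + cos th * across th f g t.
    by rewrite /along /across -[LHS]mul1r -(cos2Dsin2 th); ring.
  rewrite (le_trans (ler_normD _ _))// !normrM lerD//.
    by rewrite ler_piMl// ler_norml sin_geN1 sin_le1.
  by rewrite ler_piMl// ler_norml cos_geN1 cos_le1.
rewrite ler_pdivlMr// /wnorm.
have := lerD (H a c) (H b d).
set p := `|along th a c t|; set q := `|along th b d t|.
set u := `|across th a c t|; set v := `|across th b d t|.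
move=> /(ler_wpM2r (ltW rho0)) h; apply: le_trans h _.
have : rho * (p + q) <= 1 * (p + q) by rewrite ler_wpM2r// addr_ge0 ?normr_ge0.
by lra.
Qed.

Lemma wnorm_le1 (R : realType) (rho th : R) (a b c d : R -> R) (t : R) :
  rho <= 1 -> wnorm rho th a b c d t <= wnorm 1 th a b c d t.
Proof. by move=> rho1; rewrite lerD2l ler_wpM2r// addr_ge0. Qed.

(** The first [N] pieces are estimated with weight 1, and the others with the
    weight of [optimal_weight]. The bound at the nodes passes to the limit
    [L]. *)
Lemma row_end_bound (R : realType) (l phi : nat -> R) (r : R)
    (a b c d : R -> R) (N : nat) :
  let L := total_length l in
  let s := fun j => `|sin (phi j.+1 - phi j)| in
  (forall j, (0 < j)%N -> 0 < l j) ->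
  cvgn (fun n : nat => \sum_(1 <= j < n) l j) ->
  cvgn (fun n : nat => \sum_(1 <= j < n) s j) ->
  1 <= r ->
  abs_continuous 0 L a -> abs_continuous 0 L b ->
  abs_continuous 0 L c -> abs_continuous 0 L d ->
  a 0 = 0 -> b 0 = 0 -> c 0 = 1 -> d 0 = 0 ->
  {ae (@lebesgue_measure R), forall t, 0 < t < L ->
     row_system r (phi (piece l t)) a b c d t} ->
  `|c L| + `|d L| <= expR (1 + ln r + 3 * tail_sum s 0 + 2 * L + N%:R * (ln r + L)
      + 2 * Num.sqrt (r * tail_sum l N * tail_sum s N)).
Proof.
move=> L s l0 cl cs r1 aca acb acc acd a0 b0 c0 d0 de.
have r0 : 0 < r by lra.
have l0' j : (0 < j)%N -> 0 <= l j by move=> /l0/ltW.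
have s0 j : (0 < j)%N -> 0 <= s j by rewrite normr_ge0.
have nL n : node l n <= L by exact: sum_le_tail_sum.
have n0 n : 0 <= node l n by exact: sum_nat_ge0.
have cn : node l n @[n --> \oo] --> L.
  by have := cl; rewrite -(cvg_shiftS (fun n => \sum_(1 <= j < n) l j)).
have nI n : 0 <= node l n <= L by rewrite n0 nL.
set B := expR _.
have cc : `|c (node l n)| + `|d (node l n)| @[n --> \oo] --> `|c L| + `|d L|.
  by apply: cvgD; apply: cvg_norm; exact: (abs_continuous_cvg_end _ nI cn).
suff H n : (N <= n)%N -> `|c (node l n)| + `|d (node l n)| <= B.
  rewrite -(cvg_lim _ cc)//; apply: limr_le; first by apply/cvg_ex; eexists; exact: cc.
  by exists N => // n /= /H.
move=> Nn.
have La0 := tail_sum_ge0 N l0' cl; have S0 := tail_sum_ge0 N s0 cs.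
(* For [n >= N], the weight is 1 up to node [N] and [rho] from there on. *)
have [rho [rho0 rrho rho1 hrho]] := optimal_weight r1 S0 La0.
have La1 : tail_sum l N <= L by exact: tail_sum_le.
have S1 := tail_sum_le N s0 cs.
apply: le_trans (last_entry_le_wnorm (phi n.+1) a b c d _ rho0 rho1) _.
rewrite ler_pdivrMr//.
apply: le_trans (row_growth l0 nL (ltW r0) rho0 rho1 aca acb acc acd de Nn) _.
apply: (@le_trans _ _ (expR (tail_sum s N / rho + rho * r * tail_sum l N) *
  (expR (tail_sum s 0 + N%:R * (ln r + L)) * 2))).
  apply: ler_pM; rewrite ?expR_ge0 ?wnorm_ge0 ?(ltW rho0)//.
    rewrite ler_expR lerD//.
      by rewrite ler_wpM2r ?invr_ge0 ?(ltW rho0)//; exact: sum_le_tail_sum.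
    by rewrite ler_wpM2l ?mulr_ge0 ?(ltW rho0) ?(ltW r0)//; exact: sum_le_tail_sum.
  apply: le_trans (wnorm_le1 _ _ _ _ _ _ rho1) _.
  apply: le_trans (row_growth_crude N l0 nL r1 aca acb acc acd de) _.
  apply: ler_pM; rewrite ?expR_ge0 ?wnorm_ge0 ?ler01//.
    by rewrite ler_expR lerD2r; exact: sum_le_tail_sum.
  rewrite /wnorm /along /across a0 b0 c0 d0 !mulr0 !mulr1 !addr0 !add0r normr0 !addr0 mul1r.
  by rewrite -[2]/(1 + 1) lerD// ler_norml ?sin_geN1 ?sin_le1 ?cos_geN1 ?cos_le1.
have h2 : 2 <= expR 1 :> R by have := expR_ge1Dx (1 : R); lra.
(* The factor [1 / rho] lost in comparing the weights is at most [r]. *)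
have hr : 1 <= rho * expR (ln r).
  by rewrite lnK ?posrE// -ler_pdivrMr// mul1r.
apply: (@le_trans _ _ (expR (tail_sum s N / rho + rho * r * tail_sum l N) *
  (expR (tail_sum s 0 + N%:R * (ln r + L)) * expR 1) * (rho * expR (ln r)))).
  rewrite -[leLHS]mulr1; apply: ler_pM; rewrite ?mulr_ge0 ?expR_ge0 ?ler01//.
  by rewrite !ler_wpM2l ?expR_ge0.
have -> : expR (tail_sum s N / rho + rho * r * tail_sum l N) *
    (expR (tail_sum s 0 + N%:R * (ln r + L)) * expR 1) * (rho * expR (ln r)) =
    expR ((tail_sum s N / rho + rho * r * tail_sum l N) +
      (tail_sum s 0 + N%:R * (ln r + L)) + 1 + ln r) * rho.
  by rewrite !expRD; ring.
rewrite ler_wpM2r ?(ltW rho0)// ler_expR.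
by move: hrho La1 S1; lra.
Qed.

Unset Implicit Arguments.

Theorem proposition4p6 (R : realType) (l phi : nat -> R)
    (W : R[i] -> R -> 'M[R[i]]_2)
    (hH : limit_circle_hamburger l phi)
    (hsin : cvgn (fun n : nat => \sum_(1 <= j < n) `|sin (phi j.+1 - phi j)|))
    (hW : forall z : R[i],
        is_fundamental_solution (total_length l) (hamiltonian l phi) z (W z)) :
  exists2 C : R, 0 < C &
    \forall r \near +oo,
      ln (complex.ComplexField.Normc.normc
            (W (Complex 0 r) (total_length l) 1 1))
      <= C * (lower_inverse (Gfun l phi) (ln r / Num.sqrt r))%:R * ln r.
Proof.
have [l0 cl _] := hH.
set L := total_length l in hW *.
pose s := fun j => `|sin (phi j.+1 - phi j)|.
have l0' j : (0 < j)%N -> 0 <= l j by move=> /l0/ltW.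
have s0 j : (0 < j)%N -> 0 <= s j by rewrite normr_ge0.
have L0 : 0 <= L by exact: tail_sum_ge0.
have S0 : 0 <= tail_sum s 0 by exact: tail_sum_ge0.
exists (5 + 3 * L + 3 * tail_sum s 0); first by lra.
near=> r.
have re : expR 1 <= r by near: r; exact: nbhs_pinfty_ge.
have r1 : 1 <= r by have := expR_ge1Dx (1 : R); lra.
have r0 : 0 < r by lra.
have lnr : 1 <= ln r by rewrite -(expRK 1) ler_ln ?posrE ?expR_gt0.
have x0 : 0 < ln r / Num.sqrt r by rewrite divr_gt0 ?sqrtr_gt0//; lra.
have [N0 GN] := lower_inverse_spec (Gfun_lt x0 l0 cl hsin).
set N := lower_inverse _ _ in N0 GN *.
have N1 : 1 <= N%:R :> R by rewrite ler1n.
have Nr0 : 0 < N%:R :> R by lra.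
have La0 := tail_sum_ge0 N l0' cl; have S0' := tail_sum_ge0 N s0 hsin.
(* The left-hand side is [sqrt r * N * G N]. *)
have sqrt_le : Num.sqrt (r * tail_sum l N * tail_sum s N) <= N%:R * ln r.
  rewrite sqrtrM ?mulr_ge0 ?(ltW r0)// sqrtrM ?(ltW r0)//.
  move: GN; rewrite /Gfun -mulrA ltr_pdivlMr ?sqrtr_gt0// -!mulrA ltr_pdivrMl//.
  by move=> /ltW; rewrite [X in _ -> X <= _]mulrC -mulrA.
have hz := hW (Complex 0 r).
have [acW W0 _] := hz.
have rowW := fundamental_solution_row hz.
set w := W (Complex 0 r) in hz acW W0 rowW *.
have bound : `|complex.Re (w L 1 1)| + `|complex.Im (w L 1 1)| <=
    expR (1 + ln r + 3 * tail_sum s 0 + 2 * L + N%:R * (ln r + L)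
      + 2 * Num.sqrt (r * tail_sum l N * tail_sum s N)).
  have [ac10 ac10'] := acW 1 0; have [ac11 ac11'] := acW 1 1.
  apply: (row_end_bound _ l0 cl hsin r1 ac10 ac10' ac11 ac11' _ _ _ _ rowW);
  by rewrite W0 mxE.
have {}bound := le_trans (normc_le _) bound.
have h1 : ln r <= N%:R * ln r by rewrite ler_peMl//; lra.
have NL := le_trans lnr h1.
(* Every term is at most a constant times [N * ln r], as [N] and [ln r] are at least 1;
   these constants add up to the chosen one. *)
have main : 1 + ln r + 3 * tail_sum s 0 + 2 * L + N%:R * (ln r + L)
      + 2 * Num.sqrt (r * tail_sum l N * tail_sum s N) <=
    (5 + 3 * L + 3 * tail_sum s 0) * N%:R * ln r.
  have h2 : N%:R * L <= L * (N%:R * ln r).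
    by rewrite [leLHS]mulrC ler_wpM2l// ler_peMr//; lra.
  have h3 : L <= L * (N%:R * ln r) by rewrite ler_peMr.
  have h4 : tail_sum s 0 <= tail_sum s 0 * (N%:R * ln r) by rewrite ler_peMr.
  by rewrite -[leRHS]mulrA; move: sqrt_le h1 h2 h3 h4; lra.
set m := complex.ComplexField.Normc.normc _ in bound *.
(* [ln] takes the value 0 at 0, so a vanishing entry is a separate case. *)
have [m0|m0] := leP m 0.
  by rewrite ln0// !mulr_ge0//; lra.
apply: le_trans main; rewrite -[leRHS]expRK ler_ln ?posrE ?expR_gt0//.
Unshelve. all: by end_near. Qed.
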